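(* Let $H$ be a complex Hilbert space, let $T$ be a bounded linear operator on $H$, and let $x\in H$. If $w(T)\le 1$ and $\|x\|\le 1$, then $$\|Tx\|^2\le 2+2\sqrt{1-|\langle Tx,x\rangle|^2}.$$
   Context: For a bounded linear operator $T$ on a complex Hilbert space $H$, the numerical radius of $T$ is $w(T):=\sup\{|\langle Tx,x\rangle| : x\in H,\ \|x\|=1\}$. *)

(* Defs.v *)
From HB Require Import structures.
From mathcomp Require Import all_boot all_order all_algebra sesquilinear.
From mathcomp Require Import all_classical all_reals all_analysis.
From mathcomp Require Import complex.

Set Implicit Arguments.
Unset Strict Implicit.
Unset Printing Implicit Defensive.

Import Order.TTheory GRing.Theory Num.Theory.

Local Open Scope classical_set_scope.
Local Open Scope ring_scope.
Local Open Scope complex_scope.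

(* The inner product is linear in its first argument and conjugate-linear in
   the second. *)
HB.mixin Record CompleteNormedModule_isHilbert (R : realType) H
    of CompleteNormedModule R[i] H := {
  hdot : {dot H for Num.conj};
  hdot_norm : forall u : H, `|u| ^+ 2 = hdot u u
}.

#[short(type="hilbertType")]
HB.structure Definition Hilbert (R : realType) :=
  {H of CompleteNormedModule_isHilbert R H & CompleteNormedModule R[i] H}.

Definition bounded_operator (R : realType) (H : hilbertType R) (T : H -> H) :=
  exists M : R, forall u : H, `|T u| <= M%:C * `|u|.

(* Norms take values in R[i], where they are nonnegative reals; [complex.Re]
   brings them back to R. When H is the zero space the set is empty and its
   [sup] is 0. *)
Definition numerical_radius (R : realType) (H : hilbertType R) (T : H -> H) : R :=
  sup [set complex.Re `|hdot (T u) u| | u in [set u : H | `|u| = 1]].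

(* Main.v *)
Require Import Defs.
From HB Require Import structures.
From mathcomp Require Import all_boot all_order all_algebra sesquilinear.
From mathcomp Require Import all_classical all_reals all_analysis.
From mathcomp Require Import complex.
From mathcomp Require Import ring.

Set Implicit Arguments.
Unset Strict Implicit.
Unset Printing Implicit Defensive.

Import Order.TTheory GRing.Theory Num.Theory.

Local Open Scope ring_scope.

(** The idea.  Multiplying [T] by a unimodular scalar, assume that
    [g = <Tx, x>] is a nonnegative real.  Since [w(T) <= 1], every vector [v]
    and every [z] on the unit circle satisfy [0 <= Re (<v, v> - z <Tv, v>)].
    Fix a real [r] in [[0, 1]] and let [v = x + (z - r) / 2 * Tx].  As [z] runs
    over the circle, the expression above is the boundary value of the real
    part of a polynomial of degree 2 in [z], so it is still nonnegative when
    this polynomial is evaluated at [z = r], an average over the circle against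
    the Poisson kernel ([Re_quadratic_ge0]).  The factor [z - r] makes the
    terms containing [T (T x)], on which nothing is known, vanish at [r]; what
    remains is
      [|Tx|^2 (1 - r^2) <= 4 (|x|^2 - r g)]
    ([Poisson_numerical_bound]).  With [|x| <= 1], minimising over [r] gives
    [r = 2 g / |Tx|^2], at most 1 as soon as [2 <= |Tx|^2], and the inequality
    becomes [(|Tx|^2 - 2)^2 <= 4 (1 - g^2)] ([le_of_Poisson_bounds]). *)

(** * Averaging a quadratic polynomial over the circle *)

(** The minimum principle for the harmonic function [Re f], with [f] of degree
    at most 2.  In this degree the Poisson integral at [r] is a positive
    combination of only three point evaluations: at the roots [1], [z1], [z2]
    of [z^3 - r z^2 + r z - 1 = (z - 1) (z^2 + (1 - r) z + 1)], which for
    [r < 1] are the solutions of [z^2 (z - r) / (1 - r z) = 1], with weights [1 + r], [1 - r],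
    [1 - r] over [3 - r].  This avoids any integration. *)
Lemma Re_quadratic_ge0 (C : numClosedFieldType) (a b d r : C) :
    0 <= r -> r <= 1 ->
    (forall z : C, `|z| = 1 -> 0 <= 'Re (a + b * z + d * z ^+ 2)) ->
  0 <= 'Re (a + b * r + d * r ^+ 2).
Proof.
move=> r_ge0 r_le1 f_ge0.
have r_real : r \is Num.real by rewrite ger0_real.
pose q := (1 - r) / 2.
have q_ge0 : 0 <= q by rewrite divr_ge0 ?subr_ge0.
have q_le1 : q <= 1.
  by rewrite ler_pdivrMr // mul1r lerBlDr (le_trans (ler1n C 2)) // lerDl.
pose s := sqrtC (1 - q ^+ 2).
have s_ge0 : 0 <= s by rewrite sqrtC_ge0 subr_ge0 expr_le1.
have sE : s ^+ 2 = 1 - q ^+ 2 by rewrite sqrtCK.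
have node_norm (e : C) : e ^+ 2 = 1 -> e \is Num.real ->
    `|- q + 'i * (e * s)| = 1.
  move=> eE e_real; apply/eqP; rewrite -sqrp_eq1 //.
  have esR : e * s \is Num.real by rewrite rpredM // ger0_real.
  have qR : - q \is Num.real by rewrite rpredN ger0_real.
  by rewrite normC2_rect // exprMn eE mul1r sE; apply/eqP; ring.
pose f z := a + b * z + d * z ^+ 2.
pose z1 := - q + 'i * (1 * s); pose z2 := - q + 'i * (- 1 * s).
have f1 : 0 <= 'Re (f 1) := f_ge0 1 (normr1 _).
have fz1 : 0 <= 'Re (f z1).
  by apply/f_ge0/node_norm; rewrite ?expr1n ?rpred1.
have fz2 : 0 <= 'Re (f z2).
  by apply/f_ge0/node_norm; rewrite ?sqrrN ?expr1n ?rpredN ?rpred1.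
have r3_gt0 : 0 < 3 - r by rewrite subr_gt0 (le_lt_trans r_le1) // ltr1n.
have r1_ge0 : 0 <= 1 + r by rewrite addr_ge0.
have r2_ge0 : 0 <= 1 - r by rewrite subr_ge0.
rewrite -(pmulr_rge0 _ r3_gt0) -(ReMl (gtr0_real r3_gt0)).
have -> : (3 - r) * (a + b * r + d * r ^+ 2) =
    (1 + r) * f 1 + ((1 - r) * f z1 + (1 - r) * f z2).
  have iE : 'i ^+ 2 = -1 :> C := sqrCi C.
  have qE : 2 * q = 1 - r by rewrite mulrC divfK ?pnatr_eq0.
  have -> : r = 1 - 2 * q by rewrite qE; ring.
  by rewrite /f /z1 /z2; ring: iE sE.
rewrite !(raddfD (@Re C)) /= (ReMl (ger0_real r1_ge0)).
by rewrite !(ReMl (ger0_real r2_ge0)) !addr_ge0 ?mulr_ge0.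
Qed.

(** * From the numerical radius to a bound on the image of a vector *)

(** The test vectors are [x + (z - r) / 2 * T x] with [`|z| = 1].  On the circle
    [z^* = 1 / z], hence [z * (z - r)^* = 1 - r z]: all the terms of
    [z * <Tv, v>] are polynomials in [z], and those involving [T (T x)] carry
    the factor [z - r], so that they disappear at [z = r]. *)
Lemma Poisson_numerical_bound (C : numClosedFieldType) (U : lmodType C)
    (form : {dot U for Num.conj}) (T : {linear U -> U}) (x : U) (r : C) :
    (forall v, `|form (T v) v| <= form v v) -> 0 <= r -> r <= 1 ->
  form (T x) (T x) * (1 - r ^+ 2) <= 4 * (form x x - r * 'Re (form (T x) x)).
Proof.
move=> wT r_ge0 r_le1.
have rJ : r^* = r by apply/CrealP; rewrite ger0_real.
set y := T x; set g := form y x; set t := form y y.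
set k := form (T y) y; set m := form (T y) x.
have t_real : t \is Num.real by rewrite ger0_real // dnorm_ge0.
have x_real : form x x \is Num.real by rewrite ger0_real // dnorm_ge0.
have r_real : r \is Num.real by rewrite ger0_real.
have gJ : form x y = g^* by rewrite hermC /= expr0 mul1r.
(* The coefficients of the polynomial in [z] that has, on the circle, the same
   real part as [<v, v> - z <Tv, v>]. *)
pose a := form x x - r * g + (1 + r ^+ 2) / 4 * t - t / 2 + r / 4 * k.
pose b := r / 2 * m - (1 + r ^+ 2) / 4 * k.
pose d := r / 4 * k - m / 2.
have abd : a + b * r + d * r ^+ 2 = form x x - r * g - (1 - r ^+ 2) / 4 * t.
  by rewrite /a /b /d; field.
have vE (w : C) : form (x + w *: y) (x + w *: y) =
    form x x + w * g + w^* * g^* + w * w^* * t.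
  rewrite dnormD dnormZ normCK linearZr_LR /= gJ rmorphM /= !conjCK -/t.
  by ring.
have TvE (w : C) : form (T (x + w *: y)) (x + w *: y) =
    g + w^* * t + w * m + w * w^* * k.
  rewrite (raddfD T) /= linearZ_LR linearDl !linearDr /=.
  rewrite !linearZr_LR /= !linearZl_LR /= -/y -/g -/t -/k -/m.
  by rewrite /GRing.scale /=; ring.
have main : 0 <= 'Re (form x x - r * g - (1 - r ^+ 2) / 4 * t).
  rewrite -abd; apply: Re_quadratic_ge0 => // z z1.
  have zJ : z * z^* = 1 by rewrite -normCK z1 expr1n.
  pose w := (z - r) / 2.
  pose v := x + w *: y.
  have wJ : w^* = (z^* - r) / 2.
    by rewrite /w rmorphM rmorphB /= rJ fmorphV /= conjC_nat.
  (* [<v, v>] is not analytic in [z]: its antianalytic terms form the conjugate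
     of [p], and they are traded for [p] itself under the real part. *)
  pose c := t * r / 4.
  have cJ : c^* = c by apply/CrealP; rewrite !rpredM ?rpredV ?rpred_nat.
  pose p := w * g - c * z.
  have pJ : p^* = w^* * g^* - c * z^*.
    by rewrite /p rmorphB; congr (_ - _); rewrite rmorphM /= ?cJ.
  have -> : 'Re (a + b * z + d * z ^+ 2) = 'Re (form v v - z * form (T v) v).
    have -> : form v v - z * form (T v) v =
       a + b * z + d * z ^+ 2 + (p^* - p).
      rewrite /v vE TvE pJ wJ /p /a /b /d /c /w.
      by field: zJ.
    have pp : 'Re (p^* - p) = 0 by rewrite (raddfB (@Re C)) /= Re_conj subrr.
    by rewrite [RHS](raddfD (@Re C)) /= pp addr0.
  rewrite (raddfB (@Re C)) /= subr_ge0.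
  rewrite (Creal_ReP _ (ger0_real (dnorm_ge0 form v))).
  apply: le_trans (wT v).
  rewrite -[leRHS]mul1r -z1 -normrM.
  exact: leif_Re_Creal.
rewrite -subr_ge0.
have -> : 4 * (form x x - r * 'Re g) - t * (1 - r ^+ 2) =
    4 * 'Re (form x x - r * g - (1 - r ^+ 2) / 4 * t).
  rewrite !(raddfB (@Re C)) /= (ReMl r_real) (Creal_ReP _ x_real).
  rewrite [in RHS](Creal_ReP ((1 - r ^+ 2) / 4 * t) _).
    by field.
  by rewrite !rpredM ?rpredV ?rpredB ?rpred1 ?rpredX ?rpred_nat.
by rewrite mulr_ge0.
Qed.

(** The hypothesis is used at [r = 2 g / t], the best choice; it lies in
    [[0, 1]] when [2 <= t], and for smaller [t] the conclusion is immediate.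
    It turns the hypothesis into
    [(t - 2) ^+ 2 <= 4 * (1 - g ^+ 2)]. *)
Lemma le_of_Poisson_bounds (C : numClosedFieldType) (t g : C) :
    t \is Num.real -> 0 <= g -> g <= 1 ->
    (forall r, 0 <= r -> r <= 1 -> t * (1 - r ^+ 2) <= 4 * (1 - r * g)) ->
  t <= 2 + 2 * sqrtC (1 - g ^+ 2).
Proof.
move=> t_real g_ge0 g_le1 tg.
have s_ge0 : 0 <= 1 - g ^+ 2 by rewrite subr_ge0 expr_le1.
have [t_le2|t_gt2] := real_leP t_real (realn _ 2).
  by rewrite (le_trans t_le2) // lerDl mulr_ge0 // sqrtC_ge0.
have t_gt0 : 0 < t by apply: lt_trans t_gt2; rewrite ltr0n.
have r_ge0 : 0 <= 2 * g / t by rewrite divr_ge0 ?mulr_ge0 // ltW.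
have r_le1 : 2 * g / t <= 1.
  rewrite ler_pdivrMr // mul1r (le_trans _ (ltW t_gt2)) //.
  by rewrite ger_pMr ?ltr0n.
have d_ge0 : 0 <= t - 2 by rewrite subr_ge0 ltW.
(* It remains to prove [t - 2 <= 2 * sqrtC (1 - g ^+ 2)]; both sides are
   nonnegative and can be squared. *)
rewrite addrC -lerBlDr -(ler_pXn2r (ltn0Sn 1)) ?nnegrE ?mulr_ge0 ?sqrtC_ge0 //.
rewrite exprMn sqrtCK -subr_ge0.
have -> : 2 ^+ 2 * (1 - g ^+ 2) - (t - 2) ^+ 2 =
    t * (4 * (1 - 2 * g / t * g) - t * (1 - (2 * g / t) ^+ 2)).
  by field; rewrite gt_eqF.
by rewrite mulr_ge0 ?(ltW t_gt0) // subr_ge0 tg.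
Qed.

(** * Numerical range of a bounded operator *)

Lemma unimodular_rotation (C : numClosedFieldType) (z : C) :
  exists2 e : C, `|e| = 1 & e * z = `|z|.
Proof.
have [->|z_neq0] := eqVneq z 0.
  by exists 1; rewrite ?normr1 ?mulr0 ?normr0.
exists (`|z| / z); last by rewrite divfK.
by rewrite normrM normfV normr_id divff // normr_eq0.
Qed.

(** A weak form of the Cauchy-Schwarz inequality, in any dimension; it is only
    meant to show that the numerical range of a bounded operator is bounded. *)
Lemma dot_norm_le_average (C : numClosedFieldType) (U : lmodType C)
    (form : {dot U for Num.conj}) (u v : U) :
  2 * `|form u v| <= form u u + form v v.
Proof.
have [e e1 ez] := unimodular_rotation (form u v).
have : 0 <= form (e *: u - v) (e *: u - v) by exact: dnorm_ge0.
rewrite dnormB dnormZ e1 expr1n mul1r linearZl_LR /= ez.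
by rewrite (CrealP (normr_real _)) subr_ge0 mulr_natl mulr2n.
Qed.

Local Open Scope complex_scope.

(** Boundedness of [T] enters here: the [sup] defining the numerical radius is
    an upper bound only because the set is bounded. *)
Lemma hdot_le_numerical_radius (R : realType) (H : hilbertType R)
    (T : {linear H -> H}) (v : H) :
    bounded_operator T ->
  `|hdot (T v) v| <= (numerical_radius T)%:C * hdot v v.
Proof.
move=> [M TM].
have [->|v_neq0] := eqVneq v 0.
  by rewrite linear0r linear0r normr0 mulr0.
have nv_neq0 : `|v| != 0 by rewrite normr_eq0.
pose u := `|v|^-1 *: v.
have u1 : `|u| = 1 by rewrite normrZ normfV normr_id mulVf.
have vE : v = `|v| *: u by rewrite scalerA divff // scale1r.
have Re_norm (z : R[i]) : (complex.Re `|z|)%:C = `|z|.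
  by rewrite RRe_real ?normr_real.
have w_sup :
    has_sup [set complex.Re `|hdot (T u) u| |
              u in [set u : H | `|u| = 1]]%classic.
  split; first by exists (complex.Re `|hdot (T u) u|); exists u.
  exists ((M ^+ 2 + 1) / 2) => _ [y /= y1 <-].
  rewrite -lecR Re_norm rmorphM fmorphV rmorphD rmorphXn rmorph1 rmorph_nat.
  rewrite ler_pdivlMr ?ltr0n // mulrC (le_trans (dot_norm_le_average _ _ _)) //.
  rewrite -!hdot_norm y1 expr1n lerD2r.
  have := TM y; rewrite y1 mulr1 => Ty.
  by rewrite ler_pXn2r // nnegrE // (le_trans _ Ty).
have wu : `|hdot (T u) u| <= (numerical_radius T)%:C.
  rewrite -Re_norm lecR.
  by apply: (ub_le_sup w_sup.2); exists u.
have scale (c : R[i]) w :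
    `|hdot (T (c *: w)) (c *: w)| = `|hdot (T w) w| * `|c| ^+ 2.
  rewrite (linearZ_LR T) /= linearZl_LR linearZr_LR /= !normrM norm_conjC.
  by rewrite mulrA -expr2 mulrC.
rewrite {1 2}vE scale normr_id.
by rewrite -hdot_norm ler_wpM2r // exprn_ge0.
Qed.

Theorem theorem3p1 (R : realType) (H : hilbertType R) (T : {linear H -> H})
    (x : H) (Tbounded : bounded_operator T) (wT : numerical_radius T <= 1)
    (x_le1 : `|x| <= 1) :
  `|T x| ^+ 2 <= 2 + 2 * sqrtC (1 - `|hdot (T x) x| ^+ 2).
Proof.
have wT_le v : `|hdot (T v) v| <= hdot v v.
  apply: le_trans (hdot_le_numerical_radius v Tbounded) _.
  by rewrite ler_piMl ?dnorm_ge0 // -(rmorph1 (real_complex R)) lecR.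
have [e e1 eTx] := unimodular_rotation (hdot (T x) x).
pose eT : {linear H -> H} := e \*: T.
have weT v : `|hdot (eT v) v| <= hdot v v.
  by rewrite linearZl_LR /= normrM e1 mul1r.
have xx_le1 : hdot x x <= 1 by rewrite -hdot_norm expr_le1.
apply: le_of_Poisson_bounds.
- by rewrite ger0_real // exprn_ge0.
- exact: normr_ge0.
- exact: le_trans (wT_le x) xx_le1.
move=> r r_ge0 r_le1.
have := Poisson_numerical_bound x weT r_ge0 r_le1.
rewrite dnormZ e1 expr1n mul1r linearZl_LR /= eTx.
rewrite (Creal_ReP _ (normr_real _)) -hdot_norm => /le_trans; apply.
by rewrite ler_wpM2l // lerD2r.
Qed.
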